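(* Let $M$ be a map, i.e. a cellular embedding of a finite connected graph with edge set $E\neq\emptyset$ into a compact connected surface $S$ without boundary, and let $\Gamma$ be its map graph, with its red, green and black edges. For $A\subseteq E$, let $S_A$ be the space obtained from $S$ by deleting all the edges of $A$ and all the dual edges $e^*$ with $e\in E\setminus A$, together with their endpoints. Let $K_A$ be the $2$-regular subgraph of $\Gamma$ consisting of all black edges, the two green edges of the quadrilateral of $e$ for each $e\in A$, and the two red edges of the quadrilateral of $e$ for each $e\in E\setminus A$. Then $S_A$ is connected if and only if $K_A$ is a Hamiltonian cycle of $\Gamma$. Consequently, the collection of bases of $M$ in the sense of Bouchet (the sets $A\subseteq E$ for which $S_A$ is connected) equals the collection of sets $F\subseteq E$ for which there is a Hamiltonian cycle of $\Gamma$ that contains all black edges and whose green edges are exactly the green edges of the quadrilaterals of the edges in $F$.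
   Context: The dual graph of $M$ is drawn in $S$ with one vertex inside each face and, for each edge $e$, a dual edge $e^*$ which crosses $e$ once, at its midpoint, crosses no other edge, and joins the vertices placed in the face(s) on the two sides of $e$. The barycentric subdivision of $M$ divides $S$ into triangles called flags, four for each edge. Each flag has three corners: a vertex of the embedded graph, the midpoint of an edge, and a face center (dual vertex). Its sides are a half of an edge, a half of a dual edge, and a segment joining a vertex to a face center. The map graph $\Gamma$ is the geometric dual of the barycentric subdivision: its vertices are the flags, and for each side of the subdivision there is an edge of $\Gamma$ joining the two flags on either side of it. An edge of $\Gamma$ is red if it crosses a half-edge of the embedded graph, green if it crosses a half of a dual edge (so that it is parallel to an edge of the embedded graph), and black if it crosses a segment joining a vertex to a face center. Each color class is a perfect matching of $\Gamma$, and for each $e\in E$ the four flags at the midpoint of $e$ form a $4$-cycle of two red and two green edges, called the quadrilateral of $e$. Bouchet calls a set $A\subseteq E$ a base of the map if the non-compact surface $S_A$, obtained by deleting the edges of $A$ and the dual edges of $E\setminus A$ together with their endpoints, is connected. *)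

(* Defs.v *)
From mathcomp Require Import all_boot all_order all_algebra.
From mathcomp Require Import all_classical all_reals all_analysis.
Import numFieldNormedType.Exports.
Set Implicit Arguments.
Unset Strict Implicit.
Unset Printing Implicit Defensive.
Import Order.TTheory GRing.Theory Num.Theory.
Local Open Scope classical_set_scope.
Local Open Scope ring_scope.

(* A multigraph with vertices W and edges L is given by the map sending an    *)
(* edge to its set of ends, which is a singleton when the edge is a loop.     *)

Definition connected_multigraph (W L : finType) (ends : L -> {set W}) : Prop :=
  forall x y : W, connect (fun u v => [exists l, ends l == [set u; v]%SET]) x y.

(* A cycle is identified with its edge set, because parallel edges matter.    *)
(* On 'I_n.+1, ordS is the cyclic successor.                                  *)
Definition hamiltonian_cycle (W L : finType) (ends : L -> {set W})
    (H : {set L}) : Prop :=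
  exists (n : nat) (w : 'I_n.+1 -> W) (l : 'I_n.+1 -> L),
    [/\ bijective w, injective l,
        forall i, ends (l i) = [set w i; w (ordS i)]%SET
      & H = [set l i | i : 'I_n.+1]%SET].

(* f and g restrict to mutually inverse homeomorphisms between A and B.       *)
Definition homeomorphism (X Y : topologicalType) (A : set X) (B : set Y)
    (f : X -> Y) (g : Y -> X) : Prop :=
  [/\ {within A, continuous f} /\ {within B, continuous g},
      forall x, A x -> B (f x), forall y, B y -> A (g y),
      forall x, A x -> g (f x) = x & forall y, B y -> f (g y) = y].

Definition homeomorphic (X Y : topologicalType) (A : set X) (B : set Y) : Prop :=
  exists (f : X -> Y) (g : Y -> X), homeomorphism A B f g.

(* Second countability is omitted since compactness implies it here.          *)
Definition closed_connected_surface (R : realType) (S : topologicalType) : Prop :=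
  [/\ hausdorff_space S, compact [set: S], connected [set: S]
    & forall x : S, exists U : set S,
        [/\ open U, U x & homeomorphic U [set: (R * R)%type]]].

Definition open_disc (R : realType) : set (R * R) :=
  [set p | p.1 ^+ 2 + p.2 ^+ 2 < 1].

(* A family of arcs parametrized by [0, 1], with end points in P, which are   *)
(* allowed to meet each other, themselves and P only at their end points.     *)
Definition drawing (R : realType) (S : topologicalType) (I : Type)
    (c : I -> R -> S) (P : set S) : Prop :=
  [/\ forall i, {within `[0, 1], continuous (c i)},
      forall i, P (c i 0) /\ P (c i 1),
      forall i t, `]0, 1[%classic t -> ~ P (c i t)
    & forall i j s t, `]0, 1[%classic s -> `]0, 1[%classic t ->
        c i s = c j t -> i = j /\ s = t].

(* The two halves of an arc, and its two ends, are indexed by bool.           *)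
Definition arc_points (R : realType) (S : Type) (c : R -> S) : set S := c @` `[0, 1].

Definition half_arc (R : realType) (S : Type) (c : R -> S) (i : bool) : set S :=
  c @` (if i then `[2^-1, 1]%classic else `[0, 2^-1]%classic).

Definition arc_end (R : realType) (S : Type) (c : R -> S) (i : bool) : S :=
  c (if i then 1 else 0).

Record embedded_graph (R : realType) (S : topologicalType) (V E : finType) := {
  vertex : V -> S;
  edge : E -> R -> S;
  endv : E -> bool -> V;
  vertex_inj : injective vertex;
  edge_drawing : drawing edge (range vertex);
  edge_end : forall e i, arc_end (edge e) i = vertex (endv e i);
}.

Section Maps.
Variables (R : realType) (S : topologicalType) (V E : finType).
Variable M : embedded_graph R S V E.

Definition graph_ends (e : E) : {set V} := [set endv M e i | i : bool]%SET.

Definition graph_points : set S :=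
  range (vertex M) `|` \bigcup_e arc_points (edge M e).

Definition face (F : set S) : Prop :=
  exists2 x, (~` graph_points) x & F = connected_component (~` graph_points) x.

Definition is_map : Prop :=
  connected_multigraph graph_ends /\
  forall F, face F -> homeomorphic F (@open_disc R).

(* In crossing, the chart (f, g) makes e and e^* the two coordinate axes      *)
(* near the common midpoint.                                                  *)
Record dual_graph := {
  face_center : set S -> S;
  dual_edge : E -> R -> S;
  center_in : forall F, face F -> F (face_center F);
  dual_drawing : drawing dual_edge (face_center @` face);
  dual_mid : forall e, dual_edge e 2^-1 = edge M e 2^-1;
  dual_cross_once : forall e t, `[0, 1]%classic t ->
    graph_points (dual_edge e t) -> t = 2^-1;
  crossing : forall e, exists (U : set S) (f : S -> R * R) (g : R * R -> S),
    [/\ open U, U (edge M e 2^-1), homeomorphism U setT f g,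
        f @` (arc_points (edge M e) `&` U) = [set p | p.2 = 0]
      & f @` (arc_points (dual_edge e) `&` U) = [set p | p.1 = 0]];
}.

Variable D : dual_graph.

Definition dual_points : set S :=
  (face_center D @` face) `|` \bigcup_e arc_points (dual_edge D e).

(* The flag (e, i, j) lies between the half i of e and the half j of e^*.     *)
Definition flag := (E * bool * bool)%type.

(* The model triangle has its right angle at the midpoint (0, 0), the vertex  *)
(* of the graph at (1, 0) and the face center at (0, 1).                      *)
Definition triangle : set (R * R) :=
  [set p | [/\ 0 <= p.1, 0 <= p.2 & p.1 + p.2 <= 1]].

Definition open_triangle : set (R * R) :=
  [set p | [/\ 0 < p.1, 0 < p.2 & p.1 + p.2 < 1]].

(* B indexes the segments joining a vertex to a face center; segment_of phi   *)
(* is the one which is a side of the flag phi. That each segment has one flag *)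
(* on either side, segment_flags, is automatic for a triangulated surface.    *)
Record barycentric_subdivision (B : finType) := {
  segment : B -> R -> S;
  flag_map : flag -> R * R -> S;
  segment_of : flag -> B;
  segment_drawing : drawing segment (range (vertex M) `|` (face_center D @` face));
  segment_start : forall b, range (vertex M) (segment b 0);
  segment_stop : forall b, (face_center D @` face) (segment b 1);
  segment_avoid : forall b t, `]0, 1[%classic t ->
    ~ (graph_points `|` dual_points) (segment b t);
  segment_flags : forall b, #|[set phi | segment_of phi == b]%SET| = 2%N;
  flag_continuous : forall phi, {within triangle, continuous (flag_map phi)};
  flag_injective : forall phi, {in triangle &, injective (flag_map phi)};
  flag_midpoint : forall e i j, flag_map (e, i, j) (0, 0) = edge M e 2^-1;
  flag_vertex : forall e i j,
    flag_map (e, i, j) (1, 0) = arc_end (edge M e) i;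
  flag_center : forall e i j,
    flag_map (e, i, j) (0, 1) = arc_end (dual_edge D e) j;
  flag_half_edge : forall e i j,
    flag_map (e, i, j) @` (triangle `&` [set p | p.2 = 0])
    = half_arc (edge M e) i;
  flag_half_dual : forall e i j,
    flag_map (e, i, j) @` (triangle `&` [set p | p.1 = 0])
    = half_arc (dual_edge D e) j;
  flag_segment : forall phi,
    flag_map phi @` (triangle `&` [set p | p.1 + p.2 = 1])
    = arc_points (segment (segment_of phi));
  flag_avoid : forall phi p, open_triangle p ->
    ~ (graph_points `|` dual_points `|` \bigcup_b arc_points (segment b))
        (flag_map phi p);
  flag_disjoint : forall phi psi p q, open_triangle p -> open_triangle q ->
    flag_map phi p = flag_map psi q -> phi = psi;
  flag_cover : \bigcup_phi (flag_map phi @` triangle) = [set: S];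
}.

Section MapGraph.
Variables (B : finType) (T : barycentric_subdivision B).

(* The sides of the subdivision, which are also the edges of the map graph.   *)
Definition side := (E * bool + E * bool + B)%type.

Definition half_edge_side (e : E) (i : bool) : side := inl (inl (e, i)).
Definition half_dual_side (e : E) (j : bool) : side := inl (inr (e, j)).
Definition segment_side (b : B) : side := inr b.

Definition flag_sides (phi : flag) : {set side} :=
  let: (e, i, j) := phi in
  [set half_edge_side e i; half_dual_side e j;
       segment_side (segment_of T phi)]%SET.

Definition map_graph_ends (s : side) : {set flag} :=
  [set phi | s \in flag_sides phi]%SET.

Definition red : {set side} := [set half_edge_side e i | e : E, i : bool]%SET.
Definition green : {set side} := [set half_dual_side e j | e : E, j : bool]%SET.
Definition black : {set side} := [set segment_side b | b : B]%SET.

Definition quadrilateral (e : E) : {set side} :=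
  ([set half_edge_side e i | i : bool] :|:
   [set half_dual_side e j | j : bool])%SET.

Definition K (A : {set E}) : {set side} :=
  (black :|: \bigcup_(e in A) (green :&: quadrilateral e)
         :|: \bigcup_(e in ~: A) (red :&: quadrilateral e))%SET.

End MapGraph.

Definition S_minus (A : {set E}) : set S :=
  ~` (\bigcup_(e in [set e | e \in A]) arc_points (edge M e) `|`
      \bigcup_(e in [set e | e \notin A]) arc_points (dual_edge D e)).

Definition bases : set {set E} := [set A | connected (S_minus A)].

End Maps.

(* Main.v *)
Require Import Defs.
From mathcomp Require Import all_boot all_order all_algebra.
From mathcomp Require Import all_classical all_reals all_analysis.
From mathcomp Require Import zify ring lra.
Import numFieldNormedType.Exports.
Import Order.TTheory GRing.Theory Num.Theory.
Set Implicit Arguments.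
Unset Strict Implicit.
Unset Printing Implicit Defensive.

(* Deleting an arc from S cuts exactly the adjacencies of flags across its    *)
(* two halves, so the sides of flags which survive in S_A are those in K_A.   *)
(* A flag keeps a convex piece in S_A, and pieces of flags adjacent in K_A    *)
(* meet, so S_A is connected if K_A is. Conversely, the flags of a component  *)
(* of K_A and the other flags form two closed sets covering S_A, which meet   *)
(* inside S_A in finitely many corners only. As a disc remains connected when *)
(* a point is removed, a connected S_A cannot be split in this way. Finally,  *)
(* K_A is the union of two disjoint perfect matchings (black sides, and the   *)
(* other ones), so it is a Hamiltonian cycle as soon as it is connected.      *)

(** The link between topology and combinatorics rests on two facts. A side of the subdivision has a
    point in S_A exactly when it belongs to [K B A] ([side_points_in_K], [side_points_S_minus]), and
    outside the finite set [corners] a point of S_A lies on at most one side ([side_points_unique]).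
    So a path in K_A glues the pieces that the flags keep in S_A ([connect_S_minus]), while a proper
    component of K_A would cut S_A into two closed parts with finite overlap, which
    [connected_finite_overlap] rules out ([S_minus_connect]).

    Connectedness of K_A becomes Hamiltonicity through [hamiltonian_two_matchings], which follows
    the walk that alternates between two matchings. For the statement on bases, a Hamiltonian cycle
    with all black edges and prescribed green ones has its red edges forced by degrees, so it is
    some K_A ([hamiltonian_eq_K]). *)

Section TwoMatchings.
Variables (W L : finType) (ends : L -> {set W}).
Variables (m : bool -> W -> W) (l : bool -> W -> L).
Hypothesis ends_l : forall c x, ends (l c x) = [set x; m c x]%SET.
Hypothesis m_neq : forall c x, m c x != x.
Hypothesis mK : forall c, involutive (m c).
Hypothesis l_m : forall c x, l c (m c x) = l c x.
Hypothesis l_color : forall c d x y, l c x = l d y -> c = d.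

(** A state is a vertex together with the color of the edge to follow next; [step] is the
    alternating walk. *)
Let step (z : W * bool) : W * bool := (m z.2 z.1, ~~ z.2).
Let flip (z : W * bool) : W * bool := (z.1, ~~ z.2).

(** [flip] conjugates [step] to its inverse: changing the color at a vertex runs the walk
    backwards. *)
Let step_flip z : step (flip (step z)) = flip z.
Proof. by case: z => x c; rewrite /step /flip /= negbK mK. Qed.

Let step_inj : injective step.
Proof.
case=> x c [y d] /= [] /[swap] /negb_inj ->.
by move/(can_inj (@mK d)) ->.
Qed.

Let iter_step_flip k z : iter k step (flip (iter k step z)) = flip z.
Proof.
elim: k z => // k IH z.
by rewrite iterSr [X in flip X]iterS step_flip IH.
Qed.

Let iter_step2 k z : (iter k step z).2 = z.2 (+) odd k.
Proof. by elim: k => [|k IH] /=; [rewrite addbF | rewrite IH addbN]. Qed.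

(* A walk from (x, c) to (x, ~~ c) has odd length, and by the symmetry flip   *)
(* its middle step would join a vertex to itself.                             *)
Let no_flip k z : iter k step z != flip z.
Proof.
apply/eqP => kz.
have /esym := iter_step2 k z.
rewrite kz /= => /(congr1 (addb z.2)); rewrite addbA addbb addFb.
rewrite -[~~ z.2]addbT addbA addbb addFb => k_odd.
set j := k./2; have kE : k = (j + j.+1)%N.
  by rewrite -[LHS]odd_double_half k_odd -addnn /j; lia.
have : iter j step (iter j.+1 step z) = iter j step (flip (iter j step z)).
  by rewrite iter_step_flip -iterD -kE.
have iter_inj : injective (iter j step).
  by elim: (j) => [|i IH] // u v /step_inj/IH.
move/iter_inj => /=; rewrite /step /flip /=.
by case: (iter j _ z) => y d [] /= /eqP; rewrite (negPf (m_neq _ _)).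
Qed.

(** The orbit of [(x0, false)] under [step] is the required cycle. It visits no vertex twice by
    [no_flip], and it is closed under both matchings, so connectedness makes it visit every
    vertex. *)
Lemma hamiltonian_two_matchings (x0 : W) :
  (forall x y, connect (fun u v => [exists c, v == m c u]) x y) ->
  hamiltonian_cycle ends [set l c x | c : bool, x : W]%SET.
Proof.
move=> conn; pose z0 := (x0, false).
pose N := order step z0.
have N_gt0 : (0 < N)%N by apply: order_gt0.
pose n := N.-1; have nE : n.+1 = N by rewrite /n prednK.
pose z (i : 'I_n.+1) := iter i step z0.
have z_inj : injective z.
  move=> i j ij; apply: val_inj.
  have lti (k : 'I_n.+1) : (k < N)%N by rewrite -nE.
  by rewrite /= -(findex_iter (lti i)) -(findex_iter (lti j)) -/(z i) -/(z j) ij.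
have z_surj y : fconnect step z0 y -> exists i, z i = y.
  move=> cy; have lt : (findex step z0 y < n.+1)%N by rewrite nE findex_max.
  by exists (Ordinal lt); rewrite /z /= iter_findex.
have zS i : z (ordS i) = step (z i).
  rewrite /z /= -iterS.
  have : (i.+1 <= n.+1)%N by [].
  rewrite leq_eqVlt => /orP[/eqP -> | lt]; last by rewrite modn_small.
  by rewrite modnn nE /= (iter_order step_inj).
have z_conn i : fconnect step z0 (z i) by apply: fconnect_iter.
pose w i := (z i).1.
have w_inj : injective w.
  move=> i j ij; apply: z_inj.
  case zi : (z i) (ij) => [y c]; case zj : (z j) => [y' c']; rewrite /w zi zj /= => yy.
  (* A vertex visited in both of its states would give a walk from a state to its flip. *)
  congr pair => //; apply/eqP/negPn/negP => cc.
  have: fconnect step (z i) (z j).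
    by apply: connect_trans (z_conn j); rewrite fconnect_sym.
  move/iter_findex; rewrite zi zj.
  have -> : (y', c') = flip (y, c) by rewrite /flip /= yy; case: (c) (c') cc => [] [].
  by move/eqP; rewrite (negPf (no_flip _ _)).
(* The state [(y, c)] is entered along color [~~ c], so the mate of [y] of that color is the
   preceding vertex. With the next vertex, this accounts for both mates of [y]. *)
have orbit_m y c : fconnect step z0 (y, c) -> fconnect step z0 (m (~~ c) y, ~~ c).
  move=> zy; apply: connect_trans zy _; rewrite fconnect_sym //.
  have <- : step (m (~~ c) y, ~~ c) = (y, c) by rewrite /step /= negbK mK.
  exact: fconnect1.
have w_surj y : exists i, w i = y.
  suff: exists c, fconnect step z0 (y, c).
    by case=> c /z_surj[i ziE]; exists i; rewrite /w ziE.
  have /connectP[p] := conn x0 y.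
  elim/last_ind: p y => [|p u IH] y /=; first by move=> _ ->; exists false; apply: connect0.
  rewrite rcons_path last_rcons => /andP[xp /existsP[c /eqP uE]] ->.
  have [d zd] := IH _ xp erefl; rewrite uE.
  have [<-|] := eqVneq d c.
    by exists (~~ d); apply: connect_trans zd (fconnect1 step _).
  move=> dc; have -> : c = ~~ d by case: (c) (d) dc => [] [].
  by exists (~~ d); apply: orbit_m.
have w_bij : bijective w.
  apply: inj_card_bij => //.
  rewrite -(card_codom w_inj); apply/subset_leq_card/fintype.subsetP => y _.
  by have [i <-] := w_surj y; apply: codom_f.
pose f i := l (z i).2 (w i).
have endsf i : ends (f i) = [set w i; w (ordS i)]%SET.
  by rewrite /f ends_l /w zS.
have col i j : f i = f j -> (z i).2 = (z j).2 by move/l_color.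
have same c x y : y \in ends (l c x) -> l c y = l c x.
  by rewrite ends_l !inE => /orP[] /eqP -> //; rewrite l_m.
exists n, w, f; split => //.
  (* Equal edges have equal colors and consecutive steps have opposite ones, so [w i] is the start
     of [f j] and not its end. *)
  move=> i j ij; have := col _ _ ij.
  have : w i \in ends (f j) by rewrite -ij endsf !inE eqxx.
  rewrite endsf !inE => /orP[/eqP/w_inj //|/eqP/w_inj ->].
  by rewrite zS /=; case: (z j).2.
apply/setP => s; apply/imset2P/imsetP => [[c x _ _ ->]|[i _ ->]]; last by exists (z i).2 (w i).
have [i wi] := w_surj x.
have [cE|cN] := eqVneq (z i).2 c; first by exists i; rewrite // /f cE wi.
have [k iE] : exists k, i = ordS k by exists (ord_pred i); rewrite ord_predK.
exists k => //.
have kc : (z k).2 = c by move: cN; rewrite iE zS /=; case: (z k).2 (c) => [] [].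
by rewrite /f kc -wi; apply: same; rewrite -kc -/(f k) endsf iE !inE eqxx orbT.
Qed.
End TwoMatchings.

(** * Connectedness and degrees of Hamiltonian cycles *)

Section HamiltonianCycle.
Variables (W L : finType) (ends : L -> {set W}) (H : {set L}).
Hypothesis ham : hamiltonian_cycle ends H.

Definition linked (x y : W) : bool :=
  [exists s in H, (x \in ends s) && (y \in ends s)].

Lemma hamiltonian_connect x y : connect linked x y.
Proof.
case: ham => n [w] [l] [w_bij l_inj endsE HE].
have link i : linked (w i) (w (ordS i)).
  by apply/exists_inP; exists (l i); rewrite ?endsE ?inE ?eqxx ?orbT // HE imset_f.
have linked_sym : connect_sym linked.
  by apply: sym_connect_sym => u v; apply: eq_existsb => s; rewrite [(v \in _) && _]andbC.
have conn0 (i : 'I_n.+1) : connect linked (w ord0) (w i).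
  case: i => k; elim: k => [|k IH] lt.
    by rewrite (_ : Ordinal lt = ord0) ?connect0 //; apply: val_inj.
  have lt' : (k < n.+1)%N by apply: ltnW.
  apply: connect_trans (IH lt') _; apply: connect1.
  rewrite (_ : Ordinal lt = ordS (Ordinal lt')) //.
  by apply: val_inj; rewrite /= modn_small.
case: w_bij => w' w'K wK; rewrite -(wK x) -(wK y).
by apply: connect_trans (conn0 _); rewrite linked_sym.
Qed.

(** The two edges are the one leaving [x] and the one entering it. They coincide only for a single
    vertex with a loop, which the cardinality hypothesis excludes. *)
Lemma hamiltonian_degree x :
  (1 < #|W|)%N -> #|[set s in H | x \in ends s]%SET| = 2%N.
Proof.
case: ham => n [w] [l] [w_bij l_inj endsE HE] card_W.
have n_gt0 : (0 < n)%N by rewrite -ltnS -[n.+1]card_ord (bij_eq_card w_bij).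
have [k <-] : exists k, w k = x by case: w_bij => w' _ wK; exists (w' x).
have -> : [set s in H | w k \in ends s]%SET = [set l k; l (ord_pred k)]%SET.
  apply/setP => s; rewrite !inE HE; apply/andP/orP.
    case=> /imsetP[i _ ->]; rewrite endsE !inE !(inj_eq (bij_inj w_bij)).
    by case/orP => /eqP -> ; [left | right; rewrite ordSK].
  by case=> /eqP ->; rewrite imset_f // endsE !inE ?ord_predK eqxx ?orbT.
rewrite cards2 (inj_eq l_inj) -(inj_eq (@ordS_inj _)) ord_predK.
suff -> : ordS k != k by [].
apply/eqP => /(congr1 val) /=; have := ltn_ord k; rewrite leq_eqVlt.
by case/orP => [/eqP kn | lt]; [rewrite kn modnn; lia | rewrite modn_small; lia].
Qed.
End HamiltonianCycle.

(** * The subgraph K_A as a union of two matchings of the map graph *)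

Section MapGraphMatchings.
Variables (R : realType) (S : topologicalType) (V E B : finType).
Variables (M : embedded_graph R S V E) (D : dual_graph M).
Variable T : barycentric_subdivision D B.
Local Notation ends := (map_graph_ends T).
Implicit Types (A : {set E}) (e : E) (i j : bool) (b : B) (s : side E B).

Lemma in_ends (phi : flag E) s : (phi \in ends s) = (s \in flag_sides T phi).
Proof. by rewrite inE. Qed.

Lemma in_ends_half_edge (phi : flag E) e i :
  (phi \in ends (half_edge_side B e i)) = (phi.1 == (e, i)).
Proof.
case: phi => [[e' i'] j']; rewrite inE /flag_sides !inE /=.
by rewrite !orbF [_ == half_edge_side B e' i']eq_sym.
Qed.

Lemma in_ends_half_dual (phi : flag E) e j :
  (phi \in ends (half_dual_side B e j)) = ((phi.1.1, phi.2) == (e, j)).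
Proof.
case: phi => [[e' i'] j']; rewrite inE /flag_sides !inE /=.
by rewrite orbF [_ == half_dual_side B e' j']eq_sym.
Qed.

Lemma in_ends_segment (phi : flag E) b :
  (phi \in ends (segment_side E b)) = (segment_of T phi == b).
Proof.
case: phi => [[e' i'] j']; rewrite inE /flag_sides !inE /=.
by rewrite [_ == segment_side E (segment_of T _)]eq_sym.
Qed.

Lemma half_edge_in_K A e i : (half_edge_side B e i \in K B A) = (e \notin A).
Proof.
rewrite /K !inE; apply/orP/idP => [[/orP[/imsetP[]//|]|]|eA].
- by case/bigcupP => e' _; rewrite inE => /andP[/imset2P[]].
- case/bigcupP => e'; rewrite !inE => e'A /andP[_ /orP[] /imsetP[] //].
  by move=> i' _ [-> _].
- right; apply/bigcupP; exists e; rewrite !inE //; apply/andP; split.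
    exact: imset2_f.
  by rewrite imset_f.
Qed.

Lemma half_dual_in_K A e j : (half_dual_side B e j \in K B A) = (e \in A).
Proof.
rewrite /K !inE; apply/orP/idP => [[/orP[/imsetP[]//|]|]|eA].
- case/bigcupP => e'; rewrite !inE => e'A /andP[_ /orP[] /imsetP[] //].
  by move=> j' _ [-> _].
- by case/bigcupP => e' _; rewrite inE => /andP[/imset2P[]].
- left; apply/orP; right; apply/bigcupP; exists e; rewrite // !inE; apply/andP; split.
    exact: imset2_f.
  by rewrite imset_f ?orbT.
Qed.

Lemma segment_in_K A b : segment_side E b \in K B A.
Proof. by rewrite /K !inE imset_f. Qed.

(** The default [phi] is never reached: by [segment_flags] exactly one other flag has the same
    segment. *)
Definition black_mate (phi : flag E) : flag E :=
  odflt phi [pick psi | (psi != phi) && (segment_of T psi == segment_of T phi)].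

Lemma ends_segment (phi : flag E) : black_mate phi != phi /\
  ends (segment_side E (segment_of T phi)) = [set phi; black_mate phi]%SET.
Proof.
have := segment_flags T (segment_of T phi).
have -> : [set psi | segment_of T psi == segment_of T phi]%SET =
    ends (segment_side E (segment_of T phi)).
  by apply/setP => psi; rewrite in_ends_segment inE.
rewrite (cardsD1 phi) in_ends_segment eqxx => -[].
set X := _ :\ phi => /eqP/cards1P[psi XE].
have inX chi : ((chi != phi) && (segment_of T chi == segment_of T phi)) = (chi == psi).
  have -> : (chi == psi) = (chi \in [set psi]%SET) by rewrite inE.
  by rewrite -XE [RHS]finset.in_setD1 in_ends_segment.
rewrite /black_mate; case: pickP => [chi|/(_ psi)]; last by rewrite inX eqxx.
rewrite inX => /eqP -> /=; have := inX psi; rewrite eqxx => /andP[psi_phi seg].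
split=> //; apply/setP => rho; rewrite in_ends_segment !inE -inX.
by have [->|] := eqVneq rho phi; rewrite ?eqxx.
Qed.

(** The color [true] is black and [false] is red or green. Crossing half [j] of the dual edge
    changes the half of [e] and keeps [j]; crossing half [i] of [e] does the opposite. *)
Definition mate A (c : bool) (phi : flag E) : flag E :=
  if c then black_mate phi else
  let: (e, i, j) := phi in if e \in A then (e, ~~ i, j) else (e, i, ~~ j).

Definition mate_side A (c : bool) (phi : flag E) : side E B :=
  if c then segment_side E (segment_of T phi) else
  let: (e, i, j) := phi in
  if e \in A then half_dual_side B e j else half_edge_side B e i.

Lemma mate_neq A c phi : mate A c phi != phi.
Proof.
case: c; first by case: (ends_segment phi).
case: phi => [[e i] j] /=.
by case: ifP => _; rewrite !xpair_eqE eqxx /=; case: (i) (j) => [] [].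
Qed.

Lemma ends_mate_side A c phi : ends (mate_side A c phi) = [set phi; mate A c phi]%SET.
Proof.
case: c; first by case: (ends_segment phi).
case: phi => [[e i] j]; apply/setP => -[[e' i'] j'] /=; rewrite !inE /=.
case: ifP => _.
  by rewrite orbF /= -[_ == inl _]/((e, j) == (e', j')) !xpair_eqE
    [e == _]eq_sym; case: (i) (j) (i') (j') => [] [] [] []; rewrite /= ?andbT ?andbF ?orbF.
by rewrite !orbF /= -[_ == inl _]/((e, i) == (e', i')) !xpair_eqE
    [e == _]eq_sym; case: (i) (j) (i') (j') => [] [] [] []; rewrite /= ?andbT ?andbF ?orbF.
Qed.

Lemma mate_side_color A c d phi psi : mate_side A c phi = mate_side A d psi -> c = d.
Proof.
by case: phi psi => [[e i] j] [[e' i'] j']; case: c; case: d => //=; case: ifP.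
Qed.

Lemma mate_side_in_K A c phi : mate_side A c phi \in K B A.
Proof.
case: c; first exact: segment_in_K.
case: phi => [[e i] j] /=.
by case: ifP => eA; rewrite ?half_dual_in_K ?half_edge_in_K ?eA.
Qed.

Lemma mate_side_mate A c phi : mate_side A c (mate A c phi) = mate_side A c phi.
Proof.
case: c => /=.
  have [_ /setP/(_ (black_mate phi))] := ends_segment phi.
  by rewrite in_ends_segment !inE eqxx orbT => /eqP ->.
by case: phi => [[e i] j] /=; case: ifP => /= eA; rewrite eA.
Qed.

(** A flag and its mate are the two ends of the same side, so the mate of the mate is one of these
    two, and it is not the mate itself. *)
Lemma mateK A c : involutive (mate A c).
Proof.
move=> phi; have /setP/(_ (mate A c (mate A c phi))) := ends_mate_side A c phi.
rewrite -[in LHS]mate_side_mate ends_mate_side !inE eqxx orbT => /esym.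
by rewrite (negPf (mate_neq _ _ _)) orbF => /eqP.
Qed.

Lemma in_K_ends A s phi :
  s \in K B A -> phi \in ends s -> exists c, s = mate_side A c phi.
Proof.
case: phi => [[e i] j]; case: s => [[[e' i']|[e' j']]|b].
- rewrite [inl _]/(half_edge_side B e' i') half_edge_in_K in_ends_half_edge.
  by move=> /[swap] /eqP[<- <-] eA; exists false; rewrite /= ifN.
- rewrite [inl _]/(half_dual_side B e' j') half_dual_in_K in_ends_half_dual.
  by move=> /[swap] /eqP[<- <-] eA; exists false; rewrite /= ifT.
- rewrite [inr _]/(segment_side E b) in_ends_segment => _ /eqP <-.
  by exists true.
Qed.

Lemma K_mate_sides A : K B A = [set mate_side A c phi | c : bool, phi : flag E]%SET.
Proof.
apply/setP => s; apply/idP/imset2P => [sK|[c phi _ _ ->]]; last exact: mate_side_in_K.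
have [phi phis] : exists phi, phi \in ends s.
  case: s {sK} => [[[e i]|[e j]]|b].
  - exists (e, i, true); rewrite -[inl _]/(half_edge_side B e i).
    by rewrite in_ends_half_edge.
  - exists (e, true, j); rewrite -[inl _]/(half_dual_side B e j).
    by rewrite in_ends_half_dual.
  - have : (0 < #|[set phi | segment_of T phi == b]%SET|)%N by rewrite segment_flags.
    by case/card_gt0P => phi; rewrite inE => phib; exists phi; rewrite in_ends_segment.
by have [c ->] := in_K_ends sK phis; exists c phi.
Qed.

Lemma connect_hamiltonian A : (0 < #|E|)%N ->
  (forall phi psi, connect (linked ends (K B A)) phi psi) ->
  hamiltonian_cycle ends (K B A).
Proof.
case/card_gt0P => e _ conn; rewrite K_mate_sides.
apply: (hamiltonian_two_matchings (ends_mate_side A) (mate_neq A) (mateK A)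
  (mate_side_mate A) (@mate_side_color A) (e, true, true)) => phi psi.
apply: connect_sub (conn phi psi) => {phi psi} phi psi /exists_inP[s sK /andP[phis psis]].
have [c sE] := in_K_ends sK phis.
move: psis; rewrite sE ends_mate_side !inE => /orP[] /eqP ->; first exact: connect0.
by apply: connect1; apply/existsP; exists c.
Qed.

Lemma green_K A :
  (green E B :&: K B A)%SET = (\bigcup_(e in A) (green E B :&: quadrilateral B e))%SET.
Proof.
apply/setP => s; rewrite inE; apply/andP/bigcupP.
  case=> sg; case/imset2P: (sg) => e j _ _ sE; rewrite sE half_dual_in_K => eA.
  by exists e; rewrite // !inE -sE sg sE imset_f ?orbT.
case=> e eA /finset.setIP[sg /finset.setUP sq]; split=> //.
case/imset2P: sg sq => e' j _ _ -> [] /imsetP[] // j' _ [-> _].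
by rewrite half_dual_in_K.
Qed.

Lemma black_sub_K A : black E B \subset K B A.
Proof. by apply/fintype.subsetP => _ /imsetP[b _ ->]; apply: segment_in_K. Qed.

(* Every flag has one black and hence exactly one more side in H, so the      *)
(* green sides of H determine the red ones.                                   *)
Lemma hamiltonian_eq_K A (H : {set side E B}) : hamiltonian_cycle ends H ->
  black E B \subset H ->
  (green E B :&: H)%SET = (\bigcup_(e in A) (green E B :&: quadrilateral B e))%SET ->
  H = K B A.
Proof.
move=> ham blackH; rewrite -green_K => /setP greenH.
have dualH e j : (half_dual_side B e j \in H) = (e \in A).
  have := greenH (half_dual_side B e j).
  by rewrite !finset.in_setI half_dual_in_K imset2_f.
have segH b : segment_side E b \in H by apply: (fintype.subsetP blackH); rewrite imset_f.
apply/setP => -[[[e i]|[e j]]|b]; last 2 first.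
- by rewrite [inl _]/(half_dual_side B e j) half_dual_in_K dualH.
- by rewrite [inr _]/(segment_side E b) segment_in_K segH.
rewrite [inl _]/(half_edge_side B e i) half_edge_in_K.
have card_flag : (1 < #|{: flag E}|)%N.
  by rewrite !card_prod !card_bool; have := max_card (pred1 e); rewrite card1; lia.
have := hamiltonian_degree ham (e, i, true) card_flag.
rewrite (cardsD1 (segment_side E (segment_of T (e, i, true)))).
rewrite inE segH in_ends_segment eqxx => -[].
rewrite add0n (cardsD1 (half_dual_side B e true)) !inE dualH eqxx /= andbT.
rewrite (cardsD1 (half_edge_side B e i)) !inE eqxx /= andbT.
set X := _ :\ _.
suff -> : X = finset.set0 by rewrite cards0 addn0; case: (_ \in A); case: (_ \in H).
by apply/setP => s; rewrite !inE; case: eqP => //; case: eqP => //; case: eqP;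
  rewrite /= ?andbF.
Qed.
End MapGraphMatchings.

Local Open Scope classical_set_scope.

(** * Convexity and connectedness in the plane *)

Section Plane.
Local Open Scope ring_scope.
Variable R : realType.
Implicit Types (A : set (R * R)) (a c p : R * R).

Lemma lt_convex (a x y t : R) : a < x -> a < y -> 0 <= t <= 1 -> a < x + t * (y - x).
Proof.
move=> ax ay /andP[t0 t1]; case: (leP x y) => xy.
  by have := mulr_ge0 t0 (_ : 0 <= y - x); rewrite subr_ge0 => /(_ xy); lra.
have t1' : 0 <= 1 - t by rewrite subr_ge0.
by have := mulr_ge0 t1' (_ : 0 <= x - y); rewrite subr_ge0 => /(_ (ltW xy)); lra.
Qed.

Lemma gt_convex (b x y t : R) : x < b -> y < b -> 0 <= t <= 1 -> x + t * (y - x) < b.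
Proof.
move=> xb yb t01.
have := @lt_convex (- b) (- x) (- y) t; rewrite !ltrN2 => /(_ xb yb t01).
by lra.
Qed.

Lemma star_shaped_connected A c :
  (forall p t, A p -> 0 <= t <= 1 ->
     A (c.1 + t * (p.1 - c.1), c.2 + t * (p.2 - c.2))) ->
  connected A.
Proof.
move=> starA.
pose f p (t : R) := (c.1 + t * (p.1 - c.1), c.2 + t * (p.2 - c.2)).
have -> : A = \bigcup_(p in A) (f p @` `[0, 1]).
  apply/seteqP; split=> [p Ap|_ [p Ap [t t01 <-]]].
    exists p => //; exists 1; first by rewrite /= in_itv /= ler01 lexx.
    by rewrite /f !mul1r !subrKC -surjective_pairing.
  by apply: starA => //; move: t01; rewrite /= in_itv.
apply: bigcup_connected => [|p _].
  exists c => p _; exists 0; first by rewrite /= in_itv /= ler01 lexx.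
  by rewrite /f !mul0r !addr0 -surjective_pairing.
apply: connected_continuous_connected.
  by apply/connected_intervalP/interval_is_interval.
apply: continuous_subspaceT.
have cont x y : continuous (fun t : R => x + t * y).
  by move=> t; apply: cvgD; [exact: cvg_cst | apply: cvgM; [exact: cvg_id | exact: cvg_cst]].
by move=> t; apply: (cvg_pair (cont _ _ t) (cont _ _ t)).
Qed.

(** A segment from the centroid to a point of the closed triangle stays in the open triangle, except
    possibly at its far end. So it does not matter which boundary points [A] keeps. *)
Lemma between_triangles_connected A :
  @open_triangle R `<=` A -> A `<=` @triangle R -> connected A.
Proof.
move=> oA At; apply: (@star_shaped_connected _ (3^-1, 3^-1)) => p t Ap /andP[t0 t1] /=.
have [p1 p2 p12] := At _ Ap.
have [->|tn1] := eqVneq t 1; first by rewrite !mul1r !subrKC -surjective_pairing.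
have {}t1 : t < 1 by rewrite lt_neqAle tn1.
have tC : 0 < 1 - t by rewrite subr_gt0.
have := mulr_ge0 t0 p1; have := mulr_ge0 t0 p2.
have /(mulr_ge0 t0) : 0 <= 1 - (p.1 + p.2) by rewrite subr_ge0.
by move=> *; apply: oA; split => /=; lra.
Qed.

Lemma open_triangle_near p r : triangle p -> 0 < r ->
  exists q, [/\ open_triangle q, q <> p & ball p r q].
Proof.
case=> p1 p2 p12 r0.
(* The target [(c, c)] is an interior point whose first coordinate differs from that of [p], so
   moving towards it really leaves [p]. All coordinates lie in the unit interval, so a fraction [t]
   below [r] keeps the displacement below [r]. *)
pose c : R := if p.1 == 3^-1 then 4^-1 else 3^-1.
have [c0 c3] : 0 < c /\ c <= 3^-1 by rewrite /c; case: ifP => _; split; lra.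
have cp : c - p.1 != 0.
  rewrite subr_eq0 /c; have [->|] := eqVneq p.1 3^-1; last by rewrite eq_sym.
  by rewrite lt_eqF // ltf_pV2 ?posrE ?ltr_nat.
pose t : R := Num.min 2^-1 (r / 2).
have t0 : 0 < t by rewrite lt_min; apply/andP; split; lra.
have tr : t < r by rewrite gt_min; apply/orP; right; lra.
have t1 : t < 1 by rewrite gt_min; apply/orP; left; lra.
exists (p.1 + t * (c - p.1), p.2 + t * (c - p.2)); split.
- have tC : 0 < 1 - t by rewrite subr_gt0.
  have := mulr_gt0 t0 c0; have := mulr_ge0 (ltW tC) p1; have := mulr_ge0 (ltW tC) p2.
  have /(mulr_ge0 (ltW tC)) : 0 <= 1 - (p.1 + p.2) by rewrite subr_ge0.
  have /(mulr_ge0 (ltW t0)) : 0 <= 3^-1 - c by rewrite subr_ge0.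
  by move=> *; split=> /=; lra.
- move=> /(congr1 fst) /= /eqP; rewrite -subr_eq0 addrC addKr mulf_eq0 gt_eqF //=.
  by rewrite (negPf cp).
- suff dist x : 0 <= x <= 1 -> `|x - (x + t * (c - x))| < r.
    by split; rewrite /= -ball_normE /=; apply: dist; lra.
  move=> /andP[x0 x1]; rewrite opprD addNKr normrN normrM gtr0_norm //.
  have : `|c - x| <= 1 by rewrite ler_norml; apply/andP; split; lra.
  by move/(ler_wpM2l (ltW t0)); rewrite mulr1 => /le_lt_trans; apply.
Qed.

Let box (a b c d : R) : set (R * R) := [set p | (a < p.1 < b) /\ (c < p.2 < d)].

Let box_connected (a b c d : R) : connected (box a b c d).
Proof.
apply: (@star_shaped_connected _ ((a + b) / 2, (c + d) / 2)).
move=> p t [/andP[p1 p2] /andP[p3 p4]] t01.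
by split; apply/andP; split; [apply: lt_convex|apply: gt_convex|apply: lt_convex
  |apply: gt_convex] => //=; lra.
Qed.

(** The ball of the product norm is an open square. Without its center it is the union of its open
    left, upper, right and lower halves, and consecutive halves overlap. *)
Lemma punctured_ball_connected a r : 0 < r -> connected (ball a r `\ a).
Proof.
case: a => x y r0; set h := r / 2.
have -> : ball (x, y) r `\ (x, y) =
    box (x - r) x (y - r) (y + r) `|` box (x - r) (x + r) y (y + r)
    `|` box x (x + r) (y - r) (y + r) `|` box (x - r) (x + r) (y - r) y.
  have ballE p : ball (x, y) r p <->
      (x - r < p.1 < x + r) /\ (y - r < p.2 < y + r).
    suff ballE1 (u v : R) : ball u r v <-> u - r < v < u + r.
      by split=> -[/ballE1 ? /ballE1 ?].
    rewrite -ball_normE /= ltr_norml.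
    by split=> /andP[? ?]; apply/andP; split; lra.
  apply/seteqP; split=> -[u v]; rewrite /setU /setD /box /=; rewrite ballE /=.
    case=> -[/andP[u1 u2] /andP[v1 v2]] uv.
    case: (ltgtP u x) => ux; first by left; left; left; rewrite u1 v1 v2.
      by left; right; rewrite u2 v1 v2.
    case: (ltgtP v y) => vy; first by right; rewrite u1 u2 v1.
      by left; left; right; rewrite u1 u2 v2.
    by case: uv; rewrite ux vy.
  by case=> [[[]|]|] [/andP[u1 u2] /andP[v1 v2]]; split;
    try (split; apply/andP; split; lra); case=> ux vy; lra.
apply: connectedU.
- by exists (x - h, y - h); split; [left; left|]; split; rewrite /= /h; apply/andP; split; lra.
- apply: connectedU; last exact: box_connected.
    by exists (x + h, y + h); split; [right|]; split; rewrite /= /h; apply/andP; split; lra.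
  apply: connectedU; try exact: box_connected.
  by exists (x - h, y + h); split; split; rewrite /= /h; apply/andP; split; lra.
- exact: box_connected.
Qed.
Lemma triangle_compact : compact (@triangle R).
Proof.
have box_compact : compact (`[0 : R, 1]%classic `*` `[0 : R, 1]%classic).
  by apply: compact_setX; exact: segment_compact.
apply: (subclosed_compact _ box_compact).
- have -> : @triangle R = fst @^-1` [set x | 0 <= x] `&` snd @^-1` [set x | 0 <= x]
      `&` (fun p => p.1 + p.2) @^-1` [set x | x <= 1].
    by apply/seteqP; split=> [p []|p [[]]].
  have fst_cont : continuous (@fst R R) by move=> p; exact: cvg_fst.
  have snd_cont : continuous (@snd R R) by move=> p; exact: cvg_snd.
  apply: closedI; first apply: closedI.
  + by apply: preimage_closed; [move=> p _; exact: fst_cont | exact: closed_ge].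
  + by apply: preimage_closed; [move=> p _; exact: snd_cont | exact: closed_ge].
  + apply: preimage_closed; last exact: closed_le.
    by move=> p _; apply: cvgD; [exact: fst_cont | exact: snd_cont].
- by move=> p [p1 p2 p12]; split; rewrite /= in_itv /=; apply/andP; split; lra.
Qed.

End Plane.

(** * Separation of open subsets of a surface *)

Section Surface.
Local Open Scope ring_scope.
Variables (R : realType) (S : topologicalType).

(** A chart at [x] carries a small punctured square into [N]. This is where S being locally a plane
    enters. *)
Lemma punctured_neighborhood : closed_connected_surface R S ->
  forall (x : S) N, nbhs x N ->
  exists Y, [/\ connected Y, Y `<=` N, ~ Y x & nbhs x (x |` Y)].
Proof.
move=> [hS cS _ locS] x N Nx.
have [U [oU Ux [f [g [[fc gc] _ _ gf fg]]]]] := locS x.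
have gc' : {in [set: R * R], continuous g}.
  by rewrite -continuous_open_subspace //; exact: openT.
have : nbhs (f x) (g @^-1` N) by apply: gc'; rewrite ?in_setT // gf.
case/nbhs_ballP => r /= r0 ballN.
exists (g @` (ball (f x) r `\ f x)); split.
- apply: connected_continuous_connected; first exact: punctured_ball_connected.
  exact: continuous_subspaceW gc.
- by move=> _ [p [pr _] <-]; apply: ballN.
- by case=> p [_ /[swap] px]; apply; rewrite /= -px fg.
- have fx : {for x, continuous f}.
    by move: fc; rewrite continuous_open_subspace // => fc; apply: fc; rewrite inE.
  have : nbhs x (U `&` f @^-1` (ball (f x) r)).
    apply: filterI; first exact: open_nbhs_nbhs.
    by apply: fx; apply: nbhsx_ballx.
  apply: filterS => y [Uy fy] /=.
  have [->|yx] := eqVneq y x; [by left|right].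
  exists (f y); last by rewrite gf.
  by split=> //= fyx; move/eqP: yx; apply; rewrite -(gf y) // fyx gf.
Qed.

(* Z and Z' would separate a connected punctured neighborhood of a common     *)
(* point, because they both approach it and overlap in P only.                *)
Lemma connected_finite_overlap (O P Z Z' : set S) :
  closed_connected_surface R S ->
  open O -> finite_set P -> closed Z -> closed Z' ->
  (forall x N, Z x -> nbhs x N -> exists y, [/\ Z y, N y & y <> x]) ->
  (forall x N, Z' x -> nbhs x N -> exists y, [/\ Z' y, N y & y <> x]) ->
  O `<=` Z `|` Z' -> O `&` Z `&` Z' `<=` P ->
  connected O -> O `&` Z !=set0 -> O `<=` Z.
Proof.
move=> surfS oO finP cZ cZ' accZ accZ' OZZ OP cO OZ.
have hS : hausdorff_space S by case: surfS.
have finc (Q : set S) : finite_set Q -> closed Q.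
  by apply: (accessible_finite_set_closed.1 (hausdorff_accessible hS)).
(* Where [Z] and [Z'] do not meet, the trace of [Z] on [Y] is relatively closed and relatively open.
   This is applied to a punctured neighborhood first and then to [O] itself. *)
have splitE Y : Y `<=` O -> Y `&` (Z `&` Z') = set0 -> Y `&` Z = Y `&` ~` Z'.
  move=> YO Y0; apply/seteqP; split=> y [Yy Zy]; split=> //.
    by move=> Z'y; suff: set0 y by []; rewrite -Y0.
  by have [] := OZZ y (YO _ Yy).
have OZZ0 : O `&` (Z `&` Z') = set0.
  apply/seteqP; split=> // x [Ox [Zx Z'x]].
  (* Since [P] is finite, a neighborhood of [x] can exclude its other points; then [Z] and [Z'] are
     disjoint on the punctured neighborhood [Y]. *)
  have Nx : nbhs x (O `&` ~` (P `\ x)).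
    apply: filterI; first exact: open_nbhs_nbhs.
    apply: open_nbhs_nbhs; split; last by case=> _; apply.
    by apply: closed_openC; apply: finc; apply: finite_setD.
  have [Y [cY YN Yx nY]] := punctured_neighborhood surfS Nx.
  have YO : Y `<=` O by move=> y /YN[].
  have Y0 : Y `&` (Z `&` Z') = set0.
    apply/seteqP; split=> // y [Yy [Zy Z'y]]; have [Oy] := YN _ Yy.
    by apply; split; [apply: OP | move=> yx; apply: Yx; rewrite -yx].
  have inY (W : set S) : (forall x N, W x -> nbhs x N -> exists y, [/\ W y, N y & y <> x]) ->
      W x -> exists y, Y y /\ W y.
    by move=> accW Wx; have [y [Wy [/= ->|Yy] yx]] := accW _ _ Wx nY; [|exists y].
  have [y [Yy Z'y]] := inY _ accZ' Z'x.
  have YZ : Y `&` Z = Y.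
    apply: cY.
    - by have [z [Yz Zz]] := inY _ accZ Zx; exists z.
    - by exists (~` Z'); [exact: closed_openC | exact: splitE].
    - by exists Z.
  by suff: set0 y by []; rewrite -Y0; split=> //; split=> //; move: Yy; rewrite -{1}YZ => -[].
have OZE : O `&` Z = O.
  apply: cO => //.
  - by exists (~` Z'); [exact: closed_openC | exact: splitE].
  - by exists Z.
by rewrite -OZE => x [].
Qed.
End Surface.

(** * Halves of arcs in a drawing *)

Section Arcs.
Local Open Scope ring_scope.
Variables (R : realType) (S : topologicalType).

Lemma half_arc_sub (c : R -> S) k : half_arc c k `<=` arc_points c.
Proof.
move=> _ [t t01 <-]; exists t => //.
by case: k t01 => /=; rewrite !in_itv /= => /andP[? ?]; apply/andP; split; lra.
Qed.

Lemma arc_interior (c : R -> S) t :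
  `[0, 1]%classic t -> (forall k, arc_end c k <> c t) -> `]0, 1[%classic t.
Proof.
rewrite /= !in_itv /= => /andP[t0 t1] ct.
have tn0 : t != 0 by apply/eqP => t_eq; have := ct false; rewrite /arc_end t_eq.
have tn1 : t != 1 by apply/eqP => t_eq; have := ct true; rewrite /arc_end t_eq.
by rewrite !lt_neqAle t0 t1 tn1 [0 == t]eq_sym tn0.
Qed.

Lemma half_arc_interior (c : R -> S) k x :
  half_arc c k x -> (forall k, arc_end c k <> x) ->
  exists t, [/\ `]0, 1[%classic t, c t = x & if k then 2^-1 <= t else t <= 2^-1].
Proof.
move=> [t tk <-] ct; exists t; split => //.
  apply: (arc_interior _ ct); move: tk.
  by case: k => /=; rewrite !in_itv /= => /andP[? ?]; apply/andP; split; lra.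
by case: k tk => /=; rewrite in_itv /= => /andP[].
Qed.

(** An interior point of an arc determines both the arc and its parameter, and the two halves share
    only the parameter of the midpoint. *)
Lemma half_arc_unique (I : Type) (c : I -> R -> S) P i j k l x :
  drawing c P -> half_arc (c i) k x -> half_arc (c j) l x ->
  (forall i k, arc_end (c i) k <> x) -> c i 2^-1 <> x -> (i, k) = (j, l).
Proof.
move=> [_ _ _ c_inj] ik jl ends mid.
have [s [s01 cs sk]] := half_arc_interior ik (ends i).
have [t [t01 ct tl]] := half_arc_interior jl (ends j).
have [ij st] := c_inj _ _ _ _ s01 t01 (etrans cs (esym ct)).
congr pair => //; apply/eqP/negPn/negP => kl.
by apply: mid; rewrite -cs; congr (c i _); case: k l sk tl kl {ik jl} => [] [] //=; lra.
Qed.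

Lemma arc_closed (I : Type) (c : I -> R -> S) P i :
  hausdorff_space S -> drawing c P -> closed (arc_points (c i)).
Proof.
move=> hS [cc _ _ _]; apply: compact_closed => //.
by apply: continuous_compact; [exact: cc | exact: segment_compact].
Qed.
End Arcs.

(** * Flags and their sides inside S_A *)

Section FlagGeometry.
Local Open Scope ring_scope.
Variables (R : realType) (S : topologicalType) (V E B : finType).
Variables (M : embedded_graph R S V E) (D : dual_graph M).
Variable T : barycentric_subdivision D B.
Local Notation ends := (map_graph_ends T).
Local Notation flag_set phi := (flag_map T phi @` @triangle R).
Implicit Types (A : {set E}) (e : E) (i j : bool) (b : B) (s : side E B).

(* The corners of the flags, apart from the midpoints of the edges.           *)
Definition corners : set S :=
  [set arc_end (edge M ei.1) ei.2 | ei in [set: E * bool]] `|`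
  [set arc_end (dual_edge D ej.1) ej.2 | ej in [set: E * bool]] `|`
  [set arc_end (segment T bk.1) bk.2 | bk in [set: B * bool]].

Lemma finite_corners : finite_set corners.
Proof.
by rewrite !finite_setU; split; [split|]; apply: finite_image; exact: finite_finset.
Qed.

Lemma corners_ends x : ~ corners x ->
  [/\ forall e i, arc_end (edge M e) i <> x,
      forall e j, arc_end (dual_edge D e) j <> x
    & forall b k, arc_end (segment T b) k <> x].
Proof.
move=> Px; split=> [e i|e j|b k] xE; apply: Px.
- by left; left; exists (e, i).
- by left; right; exists (e, j).
- by right; exists (b, k).
Qed.

Definition side_points s : set S :=
  match s with
  | inl (inl (e, i)) => half_arc (edge M e) i
  | inl (inr (e, j)) => half_arc (dual_edge D e) j
  | inr b => arc_points (segment T b)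
  end.

Lemma S_minus_edge A x e : S_minus D A x -> arc_points (edge M e) x -> e \notin A.
Proof. by move=> Ax ex; apply/negP => eA; apply: Ax; left; exists e. Qed.

Lemma S_minus_dual A x e : S_minus D A x -> arc_points (dual_edge D e) x -> e \in A.
Proof. by move=> Ax ex; apply/negPn/negP => eA; apply: Ax; right; exists e. Qed.

Lemma half_in01 : `[0, 1]%classic (2^-1 : R).
Proof. by rewrite /= in_itv /=; apply/andP; split; lra. Qed.

(** The midpoint lies on [e] and on its dual edge, one of which is deleted. This is why [corners]
    can leave the midpoints out. *)
Lemma S_minus_midpoint A x e : S_minus D A x -> edge M e 2^-1 <> x.
Proof.
move=> Ax xE.
have : e \notin A by apply: (S_minus_edge Ax); exists 2^-1 => //; exact: half_in01.
have -> // : e \in A; apply: (S_minus_dual Ax); exists 2^-1; first exact: half_in01.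
by rewrite dual_mid.
Qed.

Lemma arc_graph e : arc_points (edge M e) `<=` graph_points M.
Proof. by move=> x ex; right; exists e. Qed.

Lemma arc_dual e : arc_points (dual_edge D e) `<=` dual_points D.
Proof. by move=> x ex; right; exists e. Qed.

Lemma S_minus_graph_dual A x e :
  S_minus D A x -> graph_points M x -> ~ arc_points (dual_edge D e) x.
Proof.
move=> Ax gx [t t01 tx]; apply: (S_minus_midpoint (e := e) Ax).
rewrite -(dual_mid D) -tx; congr dual_edge.
by apply/esym/(dual_cross_once (d := D) (e := e) t01); rewrite tx.
Qed.

Lemma side_points_in_K A s x : S_minus D A x -> side_points s x -> s \in K B A.
Proof.
move=> Ax; case: s => [[[e i]|[e j]]|b] /=.
- by rewrite (half_edge_in_K B A e i) => /half_arc_sub /(S_minus_edge Ax).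
- by rewrite (half_dual_in_K B A e j) => /half_arc_sub /(S_minus_dual Ax).
- by rewrite (segment_in_K A b).
Qed.

Lemma segment_interior_avoid b x : ~ corners x -> arc_points (segment T b) x ->
  ~ (graph_points M `|` dual_points D) x.
Proof.
move=> /corners_ends[_ _ Px] [t t01 tx]; rewrite -tx; apply: segment_avoid.
by apply: (arc_interior t01 (c := segment T b)) => k; rewrite tx; exact: Px.
Qed.

(** Halves of arcs of one family meet only at ends and midpoints, an edge meets a dual edge only at
    a midpoint, and segments avoid both families except at their ends. All these points are corners
    or lie outside S_A. *)
Lemma side_points_unique A s s' x : S_minus D A x -> ~ corners x ->
  side_points s x -> side_points s' x -> s = s'.
Proof.
move=> Ax Px; have [Pe Pd Ps] := corners_ends Px.
have avoid b : arc_points (segment T b) x -> ~ (graph_points M `|` dual_points D) x.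
  exact: segment_interior_avoid.
case: s => [[[e i]|[e j]]|b]; case: s' => [[[e' i']|[e' j']]|b'] /= sx s'x.
- by rewrite (half_arc_unique (edge_drawing M) sx s'x Pe (S_minus_midpoint Ax)).
- case: (S_minus_graph_dual (e := e') Ax); first exact/arc_graph/half_arc_sub/sx.
  exact/half_arc_sub/s'x.
- by case: (avoid _ s'x); left; apply/arc_graph/half_arc_sub/sx.
- case: (S_minus_graph_dual (e := e) Ax); first exact/arc_graph/half_arc_sub/s'x.
  exact/half_arc_sub/sx.
- have mid : dual_edge D e 2^-1 <> x by rewrite dual_mid; exact: (S_minus_midpoint Ax).
  by rewrite (half_arc_unique (dual_drawing D) sx s'x Pd mid).
- by case: (avoid _ s'x); right; apply/arc_dual/half_arc_sub/sx.
- by case: (avoid _ sx); left; apply/arc_graph/half_arc_sub/s'x.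
- by case: (avoid _ sx); right; apply/arc_dual/half_arc_sub/s'x.
- have [_ _ _ seg_inj] := segment_drawing T.
  case: sx s'x => [t t01 tx] [t' t01' tx'].
  suff [] : b = b' /\ t = t' by move=> ->.
  apply: seg_inj; last by rewrite tx tx'.
  + by apply: (arc_interior t01 (c := segment T b)) => k; rewrite tx.
  + by apply: (arc_interior t01' (c := segment T b')) => k; rewrite tx'.
Qed.

Lemma side_points_sub (phi : flag E) s :
  s \in flag_sides T phi -> side_points s `<=` flag_set phi.
Proof.
case: phi => [[e i] j]; rewrite /flag_sides !inE => /orP[/orP[]|] /eqP -> /=.
- by rewrite -(flag_half_edge T e i j) => x [p [tp _] <-]; exists p.
- by rewrite -(flag_half_dual T e i j) => x [p [tp _] <-]; exists p.
- by rewrite -flag_segment => x [p [tp _] <-]; exists p.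
Qed.

Lemma triangle_side (phi : flag E) p : triangle p ->
  open_triangle p \/ exists2 s, s \in flag_sides T phi & side_points s (flag_map T phi p).
Proof.
case: phi => [[e i] j] tp; have [p1 p2 p12] := tp.
have [p10|p1n] := eqVneq p.1 0.
  right; exists (half_dual_side B e j); first by rewrite !inE eqxx orbT.
  by rewrite /= -(flag_half_dual T e i j); exists p.
have [p20|p2n] := eqVneq p.2 0.
  right; exists (half_edge_side B e i); first by rewrite !inE eqxx.
  by rewrite /= -(flag_half_edge T e i j); exists p.
have [p121|p12n] := eqVneq (p.1 + p.2) 1.
  right; exists (segment_side E (segment_of T (e, i, j))); first by rewrite !inE eqxx orbT.
  by rewrite /= -flag_segment; exists p.
by left; split; rewrite lt_neqAle ?p1 ?p2 ?p12 ?p12n // eq_sym ?p1n ?p2n.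
Qed.

Lemma side_points_avoid s x : side_points s x ->
  (graph_points M `|` dual_points D `|` \bigcup_b arc_points (segment T b)) x.
Proof.
case: s => [[[e i]|[e j]]|b] /= sx.
- by left; left; apply/arc_graph/half_arc_sub/sx.
- by left; right; apply/arc_dual/half_arc_sub/sx.
- by right; exists b.
Qed.

(** Either the point is interior to both triangles and the flags coincide, or it is on a side of
    both, and this is one common side lying in [K B A]. The mixed case contradicts [flag_avoid]. *)
Lemma flag_overlap A (phi psi : flag E) x : S_minus D A x -> ~ corners x ->
  flag_set phi x -> flag_set psi x -> connect (linked ends (K B A)) phi psi.
Proof.
move=> Ax Px [p tp px] [q tq qx].
have [op|[s s_phi sx]] := triangle_side phi tp.
  have [oq|[s _ sx]] := triangle_side psi tq.
    by rewrite (flag_disjoint op oq (etrans px (esym qx))) connect0.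
  by case: (@flag_avoid _ _ _ _ _ _ _ T phi p op); rewrite px -qx; exact: side_points_avoid sx.
have [oq|[s' s_psi s'x]] := triangle_side psi tq.
  by case: (@flag_avoid _ _ _ _ _ _ _ T psi q oq); rewrite qx -px; exact: side_points_avoid sx.
rewrite px in sx; rewrite qx in s'x.
apply: connect1; apply/exists_inP; exists s; first exact: side_points_in_K sx.
by rewrite !in_ends s_phi (side_points_unique Ax Px sx s'x).
Qed.

Lemma open_triangle_S_minus A (phi : flag E) p :
  open_triangle p -> S_minus D A (flag_map T phi p).
Proof.
move=> op cut; apply: (@flag_avoid _ _ _ _ _ _ _ T phi p op); left.
by case: cut => -[e _ ex]; [left; apply: arc_graph ex | right; apply: arc_dual ex].
Qed.

(** The parameters 1/4 and 3/4 are the middles of the halves. Such a point is interior to its arc,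
    hence on no other arc of the same family, and it is not the midpoint, hence on no arc of the
    dual family. For a segment any interior point will do. *)
Lemma side_points_S_minus A s : s \in K B A -> exists x, S_minus D A x /\ side_points s x.
Proof.
pose t i : R := if i then 3 / 4 else 4^-1.
have t_open i : `]0, 1[%classic (t i).
  by rewrite /= in_itv /= /t; case: i; apply/andP; split; lra.
have t_closed i : `[0, 1]%classic (t i).
  by rewrite /= in_itv /= /t; case: i; apply/andP; split; lra.
have t_half i : t i <> 2^-1 by rewrite /t; case: i; lra.
have half (c : R -> S) i : half_arc c i (c (t i)).
  by exists (t i) => //; rewrite /t; case: i => /=; rewrite in_itv /=; apply/andP; split; lra.
case: s => [[[e i]|[e j]]|b].
- rewrite [inl _]/(half_edge_side B e i) half_edge_in_K => eA.
  exists (edge M e (t i)); split; last exact: half.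
  have [_ dP intP d_inj] := edge_drawing M.
  case=> -[e' /= e'A [u u01 ue]].
    have uo : `]0, 1[%classic u.
      apply: (arc_interior u01 (c := edge M e')) => k ku; apply: (intP e (t i)) => //.
      by rewrite -ue -ku; case: k {ku}; case: (dP e').
    by have [ee _] := d_inj _ _ _ _ uo (t_open i) ue; move: eA; rewrite -ee e'A.
  have u2 : u = 2^-1.
    apply: (dual_cross_once (d := D) (e := e') u01); rewrite ue.
    by apply: (@arc_graph e); exists (t i).
  apply: (t_half i).
  have [] // := d_inj e e' (t i) 2^-1 (t_open i).
    by rewrite /= in_itv /=; apply/andP; split; lra.
  by rewrite -(dual_mid D e') -u2 ue.
- rewrite [inl _]/(half_dual_side B e j) half_dual_in_K => eA.
  exists (dual_edge D e (t j)); split; last exact: half.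
  have [_ dP intP d_inj] := dual_drawing D.
  case=> -[e' /= e'A ex].
    apply: (t_half j); apply: (dual_cross_once (d := D) (e := e) (t_closed j)).
    exact: arc_graph ex.
  case: ex => u u01 ue.
  have uo : `]0, 1[%classic u.
    apply: (arc_interior u01 (c := dual_edge D e')) => k ku; apply: (intP e (t j)) => //.
    by rewrite -ue -ku; case: k {ku}; case: (dP e').
  have [ee _] := d_inj _ _ _ _ uo (t_open j) ue; by move: e'A; rewrite ee eA.
- move=> _; exists (segment T b (t false)); split; last by exists (t false).
  move=> cut; apply: (segment_avoid (b0 := T) (b := b) (t_open false)).
  by case: cut => -[e _ ex]; [left; apply: arc_graph ex | right; apply: arc_dual ex].
Qed.

Lemma S_minus_open A : hausdorff_space S -> open (S_minus D A).
Proof.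
move=> hS; apply: closed_openC; apply: closedU.
  apply: closed_bigcup => [|e _]; first exact: finite_finset.
  exact: arc_closed hS (edge_drawing M).
apply: closed_bigcup => [|e _]; first exact: finite_finset.
exact: arc_closed hS (dual_drawing D).
Qed.

Lemma flag_set_closed (phi : flag E) : hausdorff_space S -> closed (flag_set phi).
Proof.
move=> hS; apply: compact_closed => //; apply: continuous_compact.
  exact: (@flag_continuous _ _ _ _ _ _ _ T phi).
exact: triangle_compact.
Qed.

Lemma flag_set_limit_point (phi : flag E) x N : flag_set phi x -> nbhs x N ->
  exists y, [/\ flag_set phi y, N y & y <> x].
Proof.
move=> [p tp <-] Nx.
have open_sub : @open_triangle R `<=` @triangle R.
  by move=> q [q1 q2 q12]; split; exact: ltW.
have := @flag_continuous _ _ _ _ _ _ _ T phi.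
move=> /subspace_continuousP/(_ p tp)/(_ N Nx).
rewrite /fmap /= => /nbhs_ballP[r r0 pN].
have [q [oq qp pq]] := open_triangle_near tp r0.
have tq := open_sub _ oq.
exists (flag_map T phi q); split; first by exists q.
  exact: pN.
by move/(flag_injective (b0 := T)); rewrite !inE => /(_ tq tp).
Qed.

Lemma flag_part_connected A (phi : flag E) : connected (S_minus D A `&` flag_set phi).
Proof.
have -> : S_minus D A `&` flag_set phi =
    flag_map T phi @` (@triangle R `&` flag_map T phi @^-1` S_minus D A).
  apply/seteqP; split=> [x [Ax [p tp px]]|_ [p [tp Ap] <-]]; last by split=> //; exists p.
  by exists p => //; split=> //=; rewrite px.
apply: connected_continuous_connected.
  apply: between_triangles_connected; last by move=> p [].
  move=> p op; split; first by case: op => *; split; exact: ltW.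
  exact: open_triangle_S_minus.
by apply: continuous_subspaceW (@flag_continuous _ _ _ _ _ _ _ T phi) => p [].
Qed.

Lemma connect_S_minus A : (0 < #|E|)%N ->
  (forall phi psi, connect (linked ends (K B A)) phi psi) -> connected (S_minus D A).
Proof.
case/card_gt0P => e0 _ conn.
pose phi0 : flag E := (e0, true, true).
have c_open : @open_triangle R (3^-1, 3^-1) by split => /=; lra.
have c_in : triangle (3^-1 : R, 3^-1 : R) by split => /=; lra.
pose x phi := flag_map T phi (3^-1, 3^-1).
have x_in phi : (S_minus D A `&` flag_set phi) (x phi).
  by split; [exact: open_triangle_S_minus | exists (3^-1, 3^-1)].
pose C := connected_component (S_minus D A) (x phi0).
have grow phi y : (S_minus D A `&` flag_set phi) y -> C y -> S_minus D A `&` flag_set phi `<=` C.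
  move=> phiy /same_connected_component Cy; rewrite /C Cy.
  apply: connected_component_max => //; exact: flag_part_connected.
(* Along a path of K_A, consecutive flags share a side with a point in S_A, and this point carries
   the component from one flag to the next. *)
have sub phi : S_minus D A `&` flag_set phi `<=` C.
  have /connectP[p] := conn phi0 phi.
  elim/last_ind: p phi => [|p psi IH] phi /=.
    move=> _ ->; apply: (grow phi0 (x phi0)) => //.
    by apply: connected_component_refl; case: (x_in phi0).
  rewrite rcons_path last_rcons => /andP[pathp link] ->.
  case/exists_inP: link => s sK; rewrite !in_ends => /andP[s_last s_psi].
  have [y [Ay sy]] := side_points_S_minus sK.
  apply: (grow psi y); first by split=> //; exact: side_points_sub s_psi _ sy.
  by apply: (IH _ pathp erefl); split=> //; exact: side_points_sub s_last _ sy.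
have -> : S_minus D A = C; last exact: component_connected.
apply/seteqP; split; last exact: connected_component_sub.
move=> y Ay; have : [set: S] y by [].
by rewrite -(flag_cover T) => -[phi _ phiy]; apply: (sub phi).
Qed.

Lemma S_minus_connect A : closed_connected_surface R S -> connected (S_minus D A) ->
  forall phi psi, connect (linked ends (K B A)) phi psi.
Proof.
move=> surfS cA phi psi; have hS : hausdorff_space S by case: surfS.
pose C := [set chi | connect (linked ends (K B A)) phi chi].
pose Z (X : set (flag E)) := \bigcup_(chi in X) flag_set chi.
have Zclosed X : closed (Z X).
  by apply: closed_bigcup => [|chi _]; [exact: finite_finset | exact: flag_set_closed].
have Zacc (X : set (flag E)) x N : Z X x -> nbhs x N -> exists y, [/\ Z X y, N y & y <> x].
  move=> [chi Xchi chix] Nx; have [y [chiy Ny yx]] := flag_set_limit_point chix Nx.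
  by exists y; split=> //; exists chi.
have c_open : @open_triangle R (3^-1, 3^-1) by split => /=; lra.
have c_in : triangle (3^-1 : R, 3^-1 : R) by split => /=; lra.
(* By [flag_overlap], a flag in the component [C] of [phi] and a flag outside it can meet inside S_A
   in corners only. *)
have sub : S_minus D A `<=` Z C.
  apply: (connected_finite_overlap (P := corners) (Z' := Z (~` C)) surfS) => //.
  - exact: S_minus_open.
  - exact: finite_corners.
  - exact: Zacc.
  - exact: Zacc.
  - move=> x _; have : [set: S] x by [].
    rewrite -(flag_cover T) => -[chi _ chix].
    by have [Cchi|Cchi] := pselect (C chi); [left|right]; exists chi.
  - move=> x [[Ax [chi Cchi chix]] [rho Crho rhox]].
    have [//|Px] := pselect (corners x); case: Crho.
    exact: connect_trans Cchi (flag_overlap Ax Px chix rhox).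
  - exists (flag_map T phi (3^-1, 3^-1)); split; first exact: open_triangle_S_minus.
    by exists phi; [exact: connect0 | exists (3^-1, 3^-1)].
(* The centroid of [psi] lies in some flag [chi] of [C]; being interior to [psi], it belongs to no
   other flag. *)
have [chi Cchi [p tp px]] := sub _ (open_triangle_S_minus (A := A) (phi := psi) c_open).
suff -> : psi = chi by [].
have [op|[s _ sx]] := triangle_side chi tp.
  exact: flag_disjoint c_open op (esym px).
case: (@flag_avoid _ _ _ _ _ _ _ T psi _ c_open); rewrite -px.
exact: side_points_avoid sx.
Qed.
End FlagGeometry.

Theorem mainTheorem2 (R : realType) (S : topologicalType) (V E B : finType)
    (M : embedded_graph R S V E) (D : dual_graph M)
    (T : barycentric_subdivision D B) :
  closed_connected_surface R S ->
  is_map M ->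
  (0 < #|E|)%N ->
  (forall A : {set E},
     connected (S_minus D A) <->
     hamiltonian_cycle (map_graph_ends T) (K B A)) /\
  bases D =
    [set F : {set E} | exists H : {set side E B},
       [/\ hamiltonian_cycle (map_graph_ends T) H,
           black E B \subset H
         & (green E B :&: H)%SET =
           (\bigcup_(e in F) (green E B :&: quadrilateral B e))%SET]].
Proof.
move=> surfS _ E_gt0.
have hamE A : connected (S_minus D A) <-> hamiltonian_cycle (map_graph_ends T) (K B A).
  split=> [cA|ham]; first exact/connect_hamiltonian/S_minus_connect.
  by apply: (connect_S_minus (T := T)) => // phi psi; exact: hamiltonian_connect.
split=> //; apply/seteqP; split=> [A /hamE ham|A [H [ham blackH greenH]]].
  by exists (K B A); split; [|exact: black_sub_K|exact: green_K].
by apply/hamE; rewrite -(hamiltonian_eq_K ham blackH greenH).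
Qed.
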